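(* For all integers $n\geq 4$ and $m\geq 3$, $$\hom(C_n,K_m^1)=(m-1)\bigl((m-1)^{n-1}+(-1)^n\bigr)-\sum_{k=1}^{n}t_{n,m}^k,$$ where $t_{n,m}^n=2$ if $n$ is even, $t_{n,m}^n=0$ if $n$ is odd, $t_{n,m}^{n-1}=0$, and, for $1\leq k\leq n-2$, $$\begin{aligned} t_{n,m}^k={}&\sum_{\substack{0=i_1<i_2<\cdots<i_k=n-1\\ i_j-i_{j-1}\neq 2}}\Biggl[\prod_{\substack{2\leq j\leq k\\ i_j-i_{j-1}>2}}2\,p_{i_j-i_{j-1}-2}(m)\Biggr]\\ &+\sum_{\substack{0=i_1<i_2<\cdots<i_k<n-2\\ i_j-i_{j-1}\neq 2}}\Biggl[\prod_{\substack{2\leq j\leq k\\ i_j-i_{j-1}>2}}2\,p_{i_j-i_{j-1}-2}(m)\Biggr]\cdot 2\,p_{n-i_k-2}(m)\\ &+\sum_{\substack{1<i_1<i_2<\cdots<i_k=n-1\\ i_j-i_{j-1}\neq 2}}2\,p_{i_1-1}(m)\cdot\Biggl[\prod_{\substack{2\leq j\leq k\\ i_j-i_{j-1}>2}}2\,p_{i_j-i_{j-1}-2}(m)\Biggr]\\ &+\sum_{\substack{0<i_1<i_2<\cdots<i_k<n-1\\ i_j-i_{j-1}\neq 2}}2\,p_{i_1+n-i_k-2}(m)\cdot\Biggl[\prod_{\substack{2\leq j\leq k\\ i_j-i_{j-1}>2}}2\,p_{i_j-i_{j-1}-2}(m)\Biggr]. \end{aligned}$$ Here each sum is over integer sequences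 $(i_1,\dots,i_k)$ satisfying the displayed conditions (with $i_j-i_{j-1}\neq 2$ required for all $2\leq j\leq k$), and the $p_i$ are the polynomials defined in the context.
   Context: Graphs are finite and simple. A homomorphism from $G$ to $H$ is a map $f:V(G)\to V(H)$ sending edges to edges; $\hom(G,H)$ is the number of homomorphisms from $G$ to $H$. $K_m$ is the complete graph on $m$ vertices; the quasi-complete graph $K_m^1$ ($m\geq 3$) is obtained from $K_m$ by removing one edge. The cycle $C_n$ has vertices $0,1,\dots,n-1$ and edges $01,12,\dots,(n-2)(n-1),(n-1)0$. Empty products equal $1$ and empty sums equal $0$. The polynomials $p_i(m)$. Put $p_0\equiv 1$. For $i\geq 1$ let $G_i$ be the directed graph with levels $1,\dots,i$, whose vertices are labelled $0$ or $1$; the first and the last level each consist of a single vertex, a $0$; each $0$ on a level $\leq i-2$ has one edge to a new $0$ and one edge to a new $1$ on the next level, each $1$ on a level $\leq i-2$ has exactly one edge, to a new $0$ on the next level, and each vertex on level $i-1$ has one edge to the bottom $0$ on level $i$ ($G_1$ is a single $0$; $G_2$ is two $0$'s joined by an edge). Thus the directed paths from top to bottom of $G_i$ correspond exactly to the sequences $w=(w_1,\dots,w_i)\in\{0,1\}^i$ with $w_1=w_i=0$ and no two consecutive $1$'s. Each such path contributes to $p_i$ the product of $i$ factors, one per level: the factor of level $1$ is $m-2$; for $r\geq 2$ the factor of level $r$ is $2$ if $w_r=1$, it is $m-2$ if $w_r=0$ and $w_{r-1}=1$, and it is $m-3$ if $w_r=w_{r-1}=0$. Then $p_i$ is the sum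 of these products over all such paths. For example $p_1=m-2$, $p_2=(m-2)(m-3)$, $p_3=(m-2)(m-3)^2+2(m-2)^2$. *)

(* Defs.v *)
From HB Require Import structures.
From mathcomp Require Import all_boot all_order all_algebra.

Set Implicit Arguments.
Unset Strict Implicit.
Unset Printing Implicit Defensive.

Import GRing.Theory.

Record sgraph := SGraph {
  vertex :> finType;
  adj : rel vertex;
  adj_sym : symmetric adj;
  adj_irr : irreflexive adj
}.

Definition hom_count (G H : sgraph) : nat :=
  #|[set f : {ffun G -> H} |
      [forall x, forall y, adj x y ==> adj (f x) (f y)]]|.

Section Complete.
Variable m : nat.

Definition complete_adj : rel 'I_m := fun x y => x != y.

Fact complete_adj_sym : symmetric complete_adj.
Proof. by move=> x y; rewrite /complete_adj eq_sym. Qed.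

Fact complete_adj_irr : irreflexive complete_adj.
Proof. by move=> x; rewrite /complete_adj eqxx. Qed.

Definition complete : sgraph := SGraph complete_adj_sym complete_adj_irr.

End Complete.

Section DeleteEdge.
Variables (G : sgraph) (a b : G).

Definition delete_edge_adj : rel G :=
  fun x y => adj x y && ([set x; y] != [set a; b]).

Fact delete_edge_adj_sym : symmetric delete_edge_adj.
Proof. by move=> x y; rewrite /delete_edge_adj adj_sym setUC. Qed.

Fact delete_edge_adj_irr : irreflexive delete_edge_adj.
Proof. by move=> x; rewrite /delete_edge_adj adj_irr. Qed.

Definition delete_edge : sgraph :=
  SGraph delete_edge_adj_sym delete_edge_adj_irr.

End DeleteEdge.

(* The missing edge ab is a parameter; it is an edge of K_m iff a != b. *)
Definition quasi_complete (m : nat) (a b : 'I_m) : sgraph :=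
  @delete_edge (complete m) a b.

Section Cycle.
Variable n : nat.

Definition cycle_edge (x y : 'I_n) : bool :=
  (y == x.+1 :> nat) || (x == n.-1 :> nat) && (y == 0 :> nat).

(* The conjunct x != y only matters for n = 1, where it removes a loop. *)
Definition cycle_adj : rel 'I_n :=
  fun x y => (x != y) && (cycle_edge x y || cycle_edge y x).

Fact cycle_adj_sym : symmetric cycle_adj.
Proof. by move=> x y; rewrite /cycle_adj eq_sym orbC. Qed.

Fact cycle_adj_irr : irreflexive cycle_adj.
Proof. by move=> x; rewrite /cycle_adj eqxx. Qed.

Definition cycle_graph : sgraph := SGraph cycle_adj_sym cycle_adj_irr.

End Cycle.

(* The top-to-bottom paths of the graph G_i, as words w_1 ... w_i with true
   for the label 1: w_1 = w_i = 0 and no two consecutive 1's. *)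
Definition level_path (w : seq bool) : bool :=
  [&& ~~ head false w, ~~ last false w
    & sorted (fun x y => ~~ (x && y)) w].

Local Open Scope ring_scope.

(* The index r is 0-based: this is the factor of level r.+1, whose label
   is nth false w r. *)
Definition level_factor (w : seq bool) (r : nat) : {poly int} :=
  if r == 0%N then 'X - 2%:P
  else if nth false w r then 2%:P
  else if nth false w r.-1 then 'X - 2%:P
  else 'X - 3%:P.

Definition p_poly (i : nat) : {poly int} :=
  if i == 0%N then 1
  else \sum_(w : i.-tuple bool | level_path w)
         \prod_(0 <= r < i) level_factor w r.

Section T.
Variables n m : nat.

Definition two_p (d : nat) : int := 2 * (p_poly d).[m%:Z].

Section Terms.
Variable k : nat.

(* Every index in the four sums lies between 0 and n-1, hence the type 'I_n. *)
Definition idx (s : k.-tuple 'I_n) (j : nat) : nat :=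
  nth 0%N (map val s) j.-1.

Definition gaps_ok (s : k.-tuple 'I_n) : bool :=
  sorted (fun x y : 'I_n => (x < y)%N && (y - x != 2)%N) s.

Definition gap_prod (s : k.-tuple 'I_n) : int :=
  \prod_(2 <= j < k.+1 | (2 < idx s j - idx s j.-1)%N)
     two_p (idx s j - idx s j.-1 - 2).

Definition t_sums : int :=
    \sum_(s : k.-tuple 'I_n | [&& gaps_ok s, idx s 1 == 0%N
                                & idx s k == (n - 1)%N])
       gap_prod s
  + \sum_(s : k.-tuple 'I_n | [&& gaps_ok s, idx s 1 == 0%N
                                & (idx s k < n - 2)%N])
       gap_prod s * two_p (n - idx s k - 2)
  + \sum_(s : k.-tuple 'I_n | [&& gaps_ok s, (1 < idx s 1)%N
                                & idx s k == (n - 1)%N])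
       two_p (idx s 1 - 1) * gap_prod s
  + \sum_(s : k.-tuple 'I_n | [&& gaps_ok s, (0 < idx s 1)%N
                                & (idx s k < n - 1)%N])
       two_p (idx s 1 + n - idx s k - 2) * gap_prod s.

End Terms.

(* Meaningful for 1 <= k <= n. *)
Definition t_term (k : nat) : int :=
  if k == n then (if odd n then 0 else 2)
  else if k == (n - 1)%N then 0
  else t_sums k.

End T.

(* Main.v *)
(* Closed walks turn hom(C_n, K_m^1) into the trace of the n-th power of the
   adjacency matrix.  Grouping the vertices into {a, b} and its complement
   reduces this trace, up to (m - 3)(-1)^n, to that of the n-th power of
   D = [[0, m-2], [2, m-3]].  Allowing the edge ab in the walk replaces D by
   D + E with E = E_00, whose powers have trace (m-1)^n + (-1)^n.  Expand
   (D + E)^n over the set S of positions where E is chosen: since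
   E D^g E = (D^g)_00 E, the trace of the word of a nonempty S is the product
   of the (D^(g-1))_00 over the cyclic gaps g of S.  This factor is 1 for g = 1,
   0 for g = 2 and 2 p_(g-2)(m) for g > 2, which gives the summands of the
   t_{n,m}^k; only for k = n is there an extra (-1)^n. *)
Require Import Defs.
From mathcomp Require Import all_boot all_order all_algebra.
From mathcomp Require Import ring zify.
Set Implicit Arguments.
Unset Strict Implicit.
Unset Printing Implicit Defensive.
Import GRing.Theory.
Local Open Scope ring_scope.

(** * Closed walks in a graph as traces of matrix powers *)

Lemma big_tuple_cons (R : nmodType) (T : finType) (k : nat)
    (P : pred (seq T)) (F : seq T -> R) :
  \sum_(t : k.+1.-tuple T | P t) F t =
    \sum_(x : T) \sum_(t : k.-tuple T | P (x :: t)) F (x :: t).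
Proof.
rewrite pair_big_dep /=.
rewrite (reindex (fun u : T * k.-tuple T => [tuple of u.1 :: u.2])) //.
exists (fun t : k.+1.-tuple T => (thead t, [tuple of behead t])) => [[x t] _|t _].
  by congr pair; apply: val_inj.
by rewrite [RHS]tuple_eta; apply: val_inj.
Qed.

Lemma big_tuple0 (R : nmodType) (T : finType) (P : pred (seq T))
    (F : seq T -> R) :
  \sum_(t : 0.-tuple T | P t) F t = if P [::] then F [::] else 0.
Proof.
rewrite big_mkcond (big_pred1 [tuple]) // => t.
by rewrite /= tuple0; apply/esym/eqP.
Qed.

Definition rel_mx (m : nat) (e : rel 'I_m) : 'M[int]_m :=
  \matrix_(x, y) (e x y)%:R.

Lemma rel_mx_exp (m : nat) (e : rel 'I_m) k x y :
  (rel_mx e ^+ k) x y =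
    \sum_(t : k.-tuple 'I_m) (path e x t && (last x t == y))%:R.
Proof.
elim: k x => [|k IHk] x.
  by rewrite (big_tuple0 xpredT (fun t => (path e x t && (last x t == y))%:R)) !mxE.
rewrite (big_tuple_cons _ xpredT (fun t => (path e x t && (last x t == y))%:R)).
rewrite exprS mxE; apply: eq_bigr => z _.
rewrite IHk mxE mulr_sumr; apply: eq_bigr => t _ /=.
by case: (e x z); rewrite /= ?mul1r ?mul0r.
Qed.

Lemma rel_mx_trace (m : nat) (e : rel 'I_m) k :
  \tr (rel_mx e ^+ k.+1) = #|[set t : k.+1.-tuple 'I_m | cycle e t]|%:R.
Proof.
rewrite /mxtrace; under eq_bigr do rewrite rel_mx_exp.
rewrite exchange_big /= -sum1_card natr_sum big_mkcond /=.
rewrite [RHS]big_mkcond; apply: eq_bigr => t _.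
(* [t] lists the vertices after the base point, so a closed walk is based at the last entry of [t]:
   only that [x] contributes. *)
rewrite inE (bigD1 (last (thead t) t)) //= big1 ?addr0 => [|x xNl].
  case: t => [[|x t] //= _]; rewrite eqxx andbT rcons_path andbC /=.
  by case: ifP => //= ->.
case: t xNl => [[|z t] //= _]; rewrite eq_sym => /negbTE ->.
by rewrite andbF.
Qed.

Lemma hom_cycle_trace (n m : nat) (e : rel 'I_m) (es : symmetric e)
    (ei : irreflexive e) : (2 < n)%N ->
  (hom_count (cycle_graph n) (SGraph es ei))%:Z = \tr (rel_mx e ^+ n).
Proof.
case: n => // k k2; rewrite rel_mx_trace natz; congr (_%:Z).
pose g (f : {ffun 'I_k.+1 -> 'I_m}) := [tuple f i | i < k.+1].
have g_inj : injective g.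
  move=> f1 f2 eqf; apply/ffunP => i.
  by rewrite -[f1 i](tnth_mktuple f1) -[f2 i](tnth_mktuple f2); congr tnth.
have g_surj t : exists f, g f = t.
  exists [ffun i => tnth t i]; apply: eq_from_tnth => i.
  by rewrite tnth_mktuple ffunE.
rewrite /hom_count -(card_imset _ g_inj); apply: eq_card => t.
have [f <-{t}] := g_surj t.
rewrite (mem_imset _ _ g_inj) !inE.
have nthg i : (i < k.+1)%N -> nth (f ord0) (g f) i = f (inord i).
  move=> ik; rewrite -{1}(inordK ik).
  by rewrite -(tnth_nth (f ord0) (g f) (inord i)) tnth_mktuple.
have lastg : last (f ord0) (g f) = f ord_max.
  rewrite (last_nth (f ord0)) size_tuple /= nthg //; congr (f _).
  by apply: val_inj; rewrite /= inordK.
(* This path starts at the last entry: its step 0 is the closing edge of the cycle, its step i + 1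
   joins entries i and i + 1. *)
rewrite (cycle_path (f ord0)) lastg.
apply/forallP/(pathP (f ord0)) => [hf [_|i]|ht x].
- have -> : nth (f ord0) (g f) 0 = f ord0.
    by rewrite nthg //; congr (f _); apply: val_inj; rewrite /= inordK.
  rewrite [nth _ (_ :: _) _]/=.
  apply: (implyP (forallP (hf ord_max) ord0)).
  by rewrite /= /cycle_adj /cycle_edge -val_eqE /=; lia.
- rewrite size_tuple => ik; rewrite [nth _ (_ :: _) _]/= !nthg //; last by lia.
  apply: (implyP (forallP (hf (inord i)) (inord i.+1))).
  rewrite /= /cycle_adj /cycle_edge -val_eqE /= !inordK; lia.
have step (u v : 'I_k.+1) : cycle_edge u v -> e (f u) (f v).
  case/orP=> [/eqP uv|/andP[/eqP uk /eqP v0]].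
    have := ht v; rewrite size_tuple ltn_ord => /(_ isT).
    rewrite uv [nth _ (_ :: _) _]/= !nthg ?inord_val -?uv ?inord_val //.
    by have := ltn_ord v; lia.
  have -> : u = ord_max by apply: val_inj.
  have -> : v = inord 0 by apply: val_inj; rewrite /= inordK.
  by have := ht 0; rewrite size_tuple => /(_ isT); rewrite [nth _ (_ :: _) _]/= nthg.
apply/forallP => y; apply/implyP => /= /andP[_ /orP[]]; first exact: step.
by rewrite es; apply: step.
Qed.

(** * Powers of the two-by-two quotient matrix *)

(* Index 0 stands for the class {a, b}, index 1 for the other m - 2 vertices;
   e = 1 allows the walk to use the edge ab, e = 0 forbids it. *)
Definition coarse_mx (e m : int) : 'M[int]_2 :=
  \matrix_(i, j) if i == 0 then (if j == 0 then e else m - 2)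
                 else (if j == 0 then 2 else m - 3).

Lemma mulmx2E (A B : 'M[int]_2) i j :
  (A * B) i j = A i 0 * B 0 j + A i 1 * B 1 j.
Proof.
rewrite mxE !big_ord_recl big_ord0 addr0.
by rewrite (_ : lift ord0 ord0 = 1) //; apply: val_inj.
Qed.

Lemma mxtrace2E (A : 'M[int]_2) : \tr A = A 0 0 + A 1 1.
Proof.
rewrite /mxtrace !big_ord_recl big_ord0 addr0.
by rewrite (_ : lift ord0 ord0 = 1) //; apply: val_inj.
Qed.

(** A product of two equations instead of a conjunction, so that [rewrite] can use it as a
    multi-rule. *)
Lemma coarse_mx_expS e m n j :
  ((coarse_mx e m ^+ n.+1) 0 j =
     e * (coarse_mx e m ^+ n) 0 j + (m - 2) * (coarse_mx e m ^+ n) 1 j) *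
  ((coarse_mx e m ^+ n.+1) 1 j =
     2 * (coarse_mx e m ^+ n) 0 j + (m - 3) * (coarse_mx e m ^+ n) 1 j).
Proof. by rewrite exprS !mulmx2E !mxE. Qed.

(** The eigenvalues are m - 1 and -1; the induction carries two consecutive exponents to run on the
    recurrence of order two. *)
Lemma coarse_mx1_trace m n :
  \tr (coarse_mx 1 m ^+ n) = (m - 1) ^+ n + (-1) ^+ n.
Proof.
suff [] : \tr (coarse_mx 1 m ^+ n) = (m - 1) ^+ n + (-1) ^+ n /\
  \tr (coarse_mx 1 m ^+ n.+1) = (m - 1) ^+ n.+1 + (-1) ^+ n.+1 by [].
elim: n => [|n [IH1 IH2]]; first by rewrite expr1 !mxtrace2E !mxE /=; split; ring.
split=> //; move: IH1 IH2; rewrite !mxtrace2E.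
rewrite !(coarse_mx_expS, exprS (_ - 1), exprS (-1)).
set x := _ 0 0; set y := _ 1 0; set z := _ 0 1; set t := _ 1 1.
move=> IH1 IH2.
(* Cayley-Hamilton: the trace of the matrix is m - 2, its determinant 1 - m. *)
transitivity ((m - 2) * (1 * x + (m - 2) * y + (2 * z + (m - 3) * t)) +
  (m - 1) * (x + t)).
  ring.
rewrite IH1 IH2; ring.
Qed.

(** * From K_m^1 to the quotient matrix *)

Section QuasiComplete.

Variables (m : nat) (a b : 'I_m).
Hypothesis ab : a != b.

Let e : rel 'I_m := @adj (quasi_complete a b).
Let D := coarse_mx 0 m%:Z.
Let bad : pred 'I_m := pred2 a b.

Let eE x y : e x y = (x != y) && ~~ (bad x && bad y).
Proof.
rewrite /e /= /delete_edge_adj /= /complete_adj.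
case: eqVneq => //= xy; congr negb; apply/eqP/andP => [eqxy|[]].
  by rewrite /bad /= -!in_set2 -eqxy !inE !eqxx orbT.
rewrite /bad /= => /orP[]/eqP xE /orP[]/eqP yE; move: xy; rewrite xE yE ?eqxx //.
by rewrite setUC.
Qed.

Let sum_split (F : 'I_m -> int) :
  \sum_z F z = F a + F b + \sum_(z | ~~ bad z) F z.
Proof.
rewrite (bigD1 a) //= (bigD1 b) 1?eq_sym //= addrA; congr (_ + _).
by apply: eq_bigl => z; rewrite /bad /= negb_or.
Qed.

Let card_good : \sum_(z | ~~ bad z) (1 : int) = m%:Z - 2.
Proof.
have := sum_split (fun _ => 1); rewrite sumr_const card_ord natz => ->.
ring.
Qed.

(** Nonadjacent with the same neighbours, [a] and [b] are interchangeable, so one value [q] fills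
    their block; the complement is a clique and needs a diagonal term. The identity lacks this
    shape, hence the positive exponents below. *)
Let entry (q r s t : int) (x y : 'I_m) : int :=
  if bad x then (if bad y then q else r)
  else if bad y then r else s + t * (x == y)%:R.

(* The relation 2 q + (m - 3) r = ... says that (a, z)- and (z, a)-walks are
   equinumerous; it closes the induction, which only extends walks on one side. *)
Let exp_entries n : exists q r s : int,
  [/\ forall x y, (rel_mx e ^+ n.+1) x y = entry q r s ((-1) ^+ n.+1) x y,
      (D ^+ n.+1) 0 0 = 2 * q, (D ^+ n.+1) 0 1 = (m%:Z - 2) * r,
      (D ^+ n.+1) 1 0 = 2 * r & (D ^+ n.+1) 1 1 = (m%:Z - 2) * s + (-1) ^+ n.+1] /\
     2 * q + (m%:Z - 3) * r = (m%:Z - 2) * s + (-1) ^+ n.+1.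
Proof.
elim: n => [|n [q [r [s [[IH D00 D01 D10 D11] sym]]]]].
  exists 0, 1, 1; rewrite !expr1 !mxE /=; split; last by ring.
  split=> // [x y||]; try ring.
  rewrite mxE eE /entry; case: eqVneq => [->|_] /=.
    by case: (bad y).
  by case: (bad x); case: (bad y).
(* The first step of a walk leads from [a] or [b] to any of the m - 2 other vertices, and from one
   of these to [a], [b] or the m - 3 remaining ones. *)
exists ((m%:Z - 2) * r), ((m%:Z - 2) * s + (-1) ^+ n.+1),
  (2 * r + (m%:Z - 3) * s + (-1) ^+ n.+1).
rewrite !(coarse_mx_expS _ _ n.+1) D00 D01 D10 D11.
split; last by rewrite [(-1) ^+ n.+2]exprS; ring.
split; first last.
- by rewrite [(-1) ^+ n.+2]exprS; ring.
- by rewrite -sym; ring.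
- by ring.
- by ring.
move=> x y; rewrite exprS mxE.
pose W (z : 'I_m) := (rel_mx e x z) * entry q r s ((-1) ^+ n.+1) z y.
rewrite (eq_bigr W) => [|z _]; last by rewrite IH.
have badab : bad a /\ bad b by rewrite /bad /= !eqxx orbT.
have goodS (c d : int) w : \sum_(z | ~~ bad z) (c + d * (z == w)%:R)
   = (m%:Z - 2) * c + (if bad w then 0 else d).
  rewrite big_split /= -mulr_sumr -{1}[c]mulr1 -mulr_sumr card_good mulrC; congr (_ + _).
  case: ifPn => [bw|bw].
    by rewrite big1 ?mulr0 // => z bz; case: eqVneq bz => // ->; rewrite bw.
  by rewrite (bigD1 w) //= eqxx big1 ?addr0 ?mulr1 // => z /andP[_ /negbTE ->].
have e_mx z : rel_mx e x z = ((x != z) && ~~ (bad x && bad z))%:R by rewrite mxE eE.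
rewrite sum_split {}/W !e_mx /entry !(proj1 badab) !(proj2 badab).
case: (boolP (bad x)) => bx /=.
  rewrite !andbF !mul0r !add0r.
  under eq_bigr => z bz.
    have xz : x != z by apply: contraNneq bz => <-.
    rewrite e_mx xz bx (negbTE bz) /= mul1r; over.
  case: (boolP (bad y)) => by_; first by rewrite -[r]mulr1 -mulr_sumr card_good; ring.
  by rewrite goodS (negbTE by_).
rewrite !andbT.
have xNb z : bad z -> x != z by move=> bz; apply: contraNneq bx => ->.
rewrite !xNb ?(proj1 badab) ?(proj2 badab) // !mul1r.
have Ez z : rel_mx e x z = 1 - (z == x)%:R.
  by rewrite e_mx (negbTE bx) andbT eq_sym; case: eqP; rewrite ?subrr ?subr0.
case: (boolP (bad y)) => by_.
  rewrite -sym.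
  under eq_bigr => z bz do rewrite Ez (negbTE bz) mulrBl mul1r [_ * r]mulrC -mulNr.
  rewrite goodS (negbTE bx); ring.
set t := (-1) ^+ n.+1.
(* The sum over z != x is the full sum minus one supported at x; [goodS] evaluates both. *)
transitivity (r + r + (\sum_(z | ~~ bad z) (s + t * (z == y)%:R)
   - \sum_(z | ~~ bad z) (0 + (s + t * (x == y)%:R) * (z == x)%:R))).
  congr (_ + _); rewrite -sumrB; apply: eq_bigr => z bz.
  rewrite Ez (negbTE bz) mulrBl mul1r add0r.
  by case: (eqVneq z x) => [->|_]; rewrite ?mul1r ?mulr1 ?mul0r ?mulr0.
rewrite !goodS (negbTE by_) (negbTE bx) [in RHS]exprS -/t; ring.
Qed.

(** For m >= 3, the eigenvalues beyond those of [D] are 0, on the difference of the basis vectors of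
    [a] and [b], and -1 with multiplicity m - 3, on the vectors of sum 0 supported off [a] and
    [b]. *)
Lemma quasi_complete_trace n :
  \tr (rel_mx e ^+ n.+1) = \tr (D ^+ n.+1) + (m%:Z - 3) * (-1) ^+ n.+1.
Proof.
have [q [r [s [[entries D00 _ _ D11] _]]]] := exp_entries n.
rewrite mxtrace2E D00 D11 /mxtrace.
under eq_bigr do rewrite entries.
rewrite sum_split /entry /bad /= !eqxx orbT /=.
under eq_bigr => z bz do rewrite (negbTE bz) eqxx mulr1 -[_ + _]mulr1.
rewrite -mulr_sumr card_good; ring.
Qed.

End QuasiComplete.

(** * Expansion of the trace of (D + E)^n *)

Section CornerExpansion.

Variables (R : comNzRingType) (p : nat) (D : 'M[R]_p.+1).

Let E : 'M[R]_p.+1 := delta_mx 0 0.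

Definition corner k : R := (D ^+ k) 0 0.

Definition gaps (x : nat) (s : seq nat) : seq nat :=
  pairmap (fun y z => z - y)%N x s.

(** Trace of the word of length n with E at the positions [s] and D elsewhere. A gap d leaves d - 1
    letters D between two E, whence [.-1]; the last factor is the gap across the end of the word. *)
Definition cyclic_weight (n : nat) (s : seq nat) : R :=
  if s is x :: s' then
    (\prod_(d <- gaps x s') corner d.-1) * corner (x + n - last x s').-1
  else \tr (D ^+ n).

Let EXE (A : 'M[R]_p.+1) : E * A * E = A 0 0 *: E.
Proof.
apply/matrixP => i j; rewrite !mxE (bigD1 0) //= big1 => [|k k0]; last first.
  by rewrite /E !mxE (negbTE k0) mulr0.
rewrite !mxE (bigD1 0) //= big1 => [|k k0]; last first.
  by rewrite /E !mxE (negbTE k0) andbF mul0r.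
rewrite /E !mxE !eqxx !andbT /= !addr0.
by case: (i == 0); case: (j == 0); rewrite ?mul1r ?mulr1 ?mulr0 ?mul0r.
Qed.

Let trEX (A : 'M[R]_p.+1) : \tr (E * A) = A 0 0.
Proof.
rewrite /mxtrace (bigD1 0) //= big1 => [|i i0]; last first.
  rewrite mxE big1 // => k _; by rewrite /E !mxE (negbTE i0) mul0r.
rewrite mxE (bigD1 0) //= big1 => [|k k0]; last first.
  by rewrite /E !mxE (negbTE k0) andbF mul0r.
by rewrite /E !mxE eqxx !addr0 mul1r.
Qed.

Let letter (b : bool) : 'M[R]_p.+1 := if b then E else D.

(** Here [x] is the position of the last E read and [o] the next position. Each further E closes a
    gap and splits off a scalar; the remaining power of D is the gap still open. *)
Let corner_word (t : bitseq) x o : (x < o)%N ->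
  E * D ^+ (o - x).-1 * \prod_(b <- t) letter b =
    (\prod_(d <- gaps x (mask t (iota o (size t)))) corner d.-1) *:
      (E * D ^+ (o + size t - last x (mask t (iota o (size t)))).-1).
Proof.
elim: t x o => [|[] t IH] x o xo; rewrite ?big_cons /=.
- by rewrite !big_nil scale1r mulr1 addn0.
- have := IH o o.+1 (leqnn _); rewrite subSnn expr0 mulr1 /= => IHo.
  by rewrite mulrA EXE -scalerAl IHo scalerA addSnnS.
- have := IH x o.+1 (ltnW xo); rewrite subSn ?(ltnW xo) //= => IHo.
  rewrite mulrA -[E * _ * D]mulrA -exprSr prednK ?subn_gt0 // IHo.
  by rewrite addSnnS.
Qed.

(** By cyclicity of the trace, the letters D before the first E move to the end and complete the
    open gap. *)
Let trace_word (t : bitseq) o :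
  \tr (D ^+ o * \prod_(b <- t) letter b) =
    cyclic_weight (o + size t) (mask t (iota o (size t))).
Proof.
elim: t o => [|b t IH] o; rewrite ?big_cons /=.
  by rewrite big_nil mulr1 addn0.
case: b; rewrite /=.
  have := @corner_word t o o.+1 (leqnn _); rewrite subSnn expr0 mulr1 => ->.
  rewrite -scalerAr linearZ /= mxtrace_mulC mulmxE -mulrA -exprD trEX.
  rewrite addSnnS; congr (_ * (D ^+ _) _ _).
  set s := mask _ _.
  (* Needed because subtraction is truncated in the exponents to be compared. *)
  have : (last o s < o + (size t).+1)%N.
    rewrite addnS ltnS; have := mem_last o s; rewrite inE => /orP[/eqP ->|].
      exact: leq_addr.
    by move/mem_mask; rewrite mem_iota addSn ltnS => /andP[_].
  lia.
by rewrite mulrA -exprSr IH addSnnS.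
Qed.

Lemma trace_corner_expansion n :
  \tr ((delta_mx 0 0 + D) ^+ n) =
    \sum_(S : {set 'I_n}) cyclic_weight n (map val (enum S)).
Proof.
rewrite -{1}[n]card_ord -prodr_const.
rewrite [X in \tr X](bigA_distr _ _ (fun=> E) (fun=> D)) raddf_sum.
apply: eq_bigr => S _.
transitivity (\tr (D ^+ 0 * \prod_(b <- [seq i \in S | i <- enum 'I_n]) letter b)).
  by rewrite mul1r big_map [index_enum _]unlock -enumT.
rewrite trace_word add0n size_map size_enum_ord -val_enum_ord -map_mask -filter_mask.
by rewrite !enumT.
Qed.

End CornerExpansion.

(** * The polynomials p_i as matrix entries *)

Section LevelPaths.

Variable m : int.

Let no11 : rel bool := fun x y => ~~ (x && y).

Let factor (x y : bool) : int := if y then 2 else if x then m - 2 else m - 3.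

Let path_weight (x : bool) (w : seq bool) : int :=
  \prod_(0 <= r < size w) factor (nth false (x :: w) r) (nth false w r).

(* w_1 = 0 with the factor m - 2 is what would follow a label 1: hence p_i is the
   entry (0, 1) of D^i, true and false being the indices 0 and 1. *)
Let path_sum i x :
  \sum_(w : i.-tuple bool | path no11 x w && ~~ last x w) path_weight x w =
    (coarse_mx 0 m ^+ i) (if x then 0 else 1) 1.
Proof.
elim: i x => [|i IH] x.
  rewrite (big_tuple0 (fun w => path no11 x w && ~~ last x w)) expr0 mxE /=.
  rewrite /path_weight big_nil.
  by case: x.
rewrite (big_tuple_cons _ (fun w => path no11 x w && ~~ last x w)) /=.
pose M := coarse_mx 0 m.
transitivity (\sum_y (~~ (x && y))%:R * factor x y * (M ^+ i) (if y then 0 else 1) 1).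
  apply: eq_bigr => y _; rewrite -IH mulr_sumr /no11.
  case: (x && y) => /=; first by rewrite big_pred0_eq big1 // => w _; rewrite !mul0r.
  apply: eq_bigr => w _; rewrite mul1r /path_weight /= big_nat_recl //.
rewrite big_bool /= andbT andbF /=.
by case: x; rewrite coarse_mx_expS /factor /=; ring.
Qed.

Lemma p_polyE i : (p_poly i.+1).[m] = (coarse_mx 0 m ^+ i.+1) 0 1.
Proof.
rewrite -(path_sum i.+1 true) /p_poly /= horner_sum.
apply: eq_big => [w|w].
  by case: w => [[|x w] //= _]; rewrite /level_path /= andbA andbAC.
case: w => [[|x w] //= /eqP[sz]]; rewrite /level_path /= => /andP[/negbTE x0 _].
rewrite /path_weight /= sz horner_prod !big_nat_recl // x0; congr (_ * _).
  by rewrite /level_factor /factor /= hornerD hornerN hornerX hornerC.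
apply: eq_bigr => r _; rewrite /level_factor /factor /=.
case: (nth false w r); first by rewrite hornerC.
by case: (nth _ _ _); rewrite hornerD hornerN hornerX hornerC.
Qed.

End LevelPaths.

Section Corner.

Variable m : nat.

Local Notation D := (coarse_mx 0 m%:Z).

Lemma corner0 : corner D 0 = 1.
Proof. by rewrite /corner expr0 mxE. Qed.

Lemma corner1 : corner D 1 = 0.
Proof. by rewrite /corner expr1 mxE. Qed.

(** The (0, 0) entry of [D] is 0, so the last step of a closed walk at 0 comes from index 1, with
    entry 2. *)
Lemma cornerSS i : corner D i.+2 = two_p m i.+1.
Proof.
rewrite /corner exprSr mulmx2E -p_polyE !mxE /= mulr0 add0r mulrC; congr (2 * _).
Qed.

End Corner.

(** * Subsets as increasing sequences *)

Lemma sum_sorted_tuples (R : nmodType) (n : nat) (F : seq 'I_n -> R) :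
  \sum_(S : {set 'I_n}) F (enum S) =
    \sum_(0 <= k < n.+1)
      \sum_(s : k.-tuple 'I_n | sorted ltn (map val s)) F s.
Proof.
rewrite big_mkord (partition_big (fun S : {set 'I_n} => inord #|S| : 'I_n.+1) xpredT) //=.
apply: eq_bigr => k _.
have cardS (S : {set 'I_n}) : (inord #|S| == k) = (#|S| == k).
  by rewrite -val_eqE /= inordK // ltnS -[leqRHS]card_ord max_card.
have sorted_enum (S : {set 'I_n}) : sorted ltn (map val (enum S)).
  rewrite -[enum _](eq_filter (mem_enum _)) -(eq_filter (mem_map val_inj _)).
  rewrite -filter_map (sorted_filter ltn_trans) // -enumT val_enum_ord.
  exact: iota_ltn_sorted.
(* Both sides become sums over duplicate-free lists with the same members. *)
transitivity (\sum_(s <- [seq enum A | A : {set 'I_n} in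
    [pred A : {set 'I_n} | #|A| == k]]) F s).
  by rewrite big_image; apply: eq_bigl => B; rewrite /= cardS.
transitivity (\sum_(s <- [seq val s | s : k.-tuple 'I_n in
    [pred s : k.-tuple 'I_n | sorted ltn (map val s)]]) F s); last by rewrite big_image.
apply: perm_big; apply: uniq_perm.
- rewrite map_inj_in_uniq ?enum_uniq // => S1 S2 _ _ eqS.
  by apply/setP => x; rewrite -!(mem_enum (mem (_ : {set _}))) eqS.
- by rewrite (map_inj_uniq val_inj) enum_uniq.
move=> s; apply/imageP/imageP => [[S /= /eqP cS ->]|[t /= st ->]].
  have sz : size (enum S) == k by rewrite -cardE cS.
  by exists (Tuple sz) => //=; rewrite inE /=.
have ut : uniq t.
  by rewrite -(map_inj_uniq val_inj) (sorted_uniq ltn_trans ltnn).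
exists [set x in tval t]; first by rewrite inE cardsE (card_uniqP ut) size_tuple.
apply: (inj_map val_inj); apply: (irr_sorted_eq ltn_trans ltnn) => // y.
by apply/mapP/mapP=> [] [x t_x ->]; exists x; rewrite // mem_enum inE in t_x *.
Qed.

(** * Gaps of increasing sequences and the sums t^k *)

Lemma gaps_gt0 x s : path ltn x s -> all (ltn 0) (gaps x s).
Proof. by elim: s x => //= y s IH x /andP[xy /IH ->]; rewrite andbT subn_gt0. Qed.

Section TSums.

Variables n m : nat.

Local Notation D := (coarse_mx 0 m%:Z).

Let gapsN2 x s :
  path (fun x y => (x < y)%N && (y - x != 2)%N) x s =
    path ltn x s && (2 \notin gaps x s).
Proof.
elim: s x => //= y s IH x; rewrite inE negb_or IH eq_sym.
by rewrite -!andbA; congr (_ && _); rewrite andbCA.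
Qed.

Let gap_prodE k (s : k.-tuple 'I_n) x l : map val s = x :: l ->
  gap_prod m s = \prod_(d <- gaps x l | (2 < d)%N) two_p m (d - 2).
Proof.
move=> sE; have szl : k = (size l).+1
  by rewrite -(size_tuple s) -(size_map val) sE.
rewrite /gap_prod big_add1 /= big_add1 (_ : k.-1 = size l) ?szl //.
rewrite [RHS](big_nth 0%N) /gaps size_pairmap.
rewrite big_nat_cond [RHS]big_nat_cond; apply: eq_big => [i|i].
  case ile: (i < size l)%N => //=.
  by rewrite (nth_pairmap 0%N) // /idx sE.
by move=> /andP[ile _]; rewrite (nth_pairmap 0%N) // /idx sE.
Qed.

Let corner_gaps x l : path ltn x l -> 2 \notin gaps x l ->
  \prod_(d <- gaps x l | (2 < d)%N) two_p m (d - 2) =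
    \prod_(d <- gaps x l) corner D d.-1.
Proof.
move=> /gaps_gt0/allP pos N2; rewrite big_mkcond; apply: eq_big_seq => d dG.
have := pos d dG; case: d dG => [|[|[|d]]] //= dG _.
- by rewrite corner0.
- by rewrite dG in N2.
- by rewrite cornerSS.
Qed.

Let corner_two_p c : (1 < c)%N -> corner D c = two_p m c.-1.
Proof. by case: c => [|[|c]] // _; rewrite cornerSS. Qed.

(** An inner gap 2 makes the weight 0. Otherwise the closing gap i_1 + n - i_k decides: it is 1 in
    the first sum and exceeds 2 in the other three. The two cases that no sum covers, (i_1, i_k) =
    (1, n - 1) and (0, n - 2), have closing gap 2 and weight 0. *)
Lemma t_sums_sorted k : (3 < n)%N ->
  t_sums n m k.+1 =
    \sum_(s : k.+1.-tuple 'I_n | sorted ltn (map val s))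
       cyclic_weight D n (map val s).
Proof.
move=> n3; rewrite /t_sums ![\sum_(s | [&& _, _ & _]) _]big_mkcond [RHS]big_mkcond.
rewrite -!big_split; apply: eq_bigr => s _.
case sE: (map val s) (size_map val s) => [|x l] /=; rewrite size_tuple // => -[szl].
have gE : gaps_ok s = path ltn x l && (2 \notin gaps x l).
  rewrite /gaps_ok -gapsN2.
  rewrite -[path _ x l]/(sorted (fun x y => (x < y)%N && (y - x != 2)%N) (x :: l)).
  by rewrite -sE sorted_map.
have i1 : idx s 1 = x by rewrite /idx sE.
have ik : idx s k.+1 = last x l.
  by rewrite /idx sE (last_nth 0%N) szl.
rewrite (gap_prodE sE) i1 ik gE.
have [xl|] := boolP (path ltn x l); last by rewrite !addr0.
have [N2|] := boolP (2 \in gaps x l).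
  by rewrite /= (big_rem _ N2) /= corner1 !mul0r !addr0.
move=> N2; rewrite corner_gaps //=.
have x_last : (x <= last x l)%N.
  have := order_path_min ltn_trans xl => /allP xmin.
  have := mem_last x l; rewrite inE => /orP[/eqP ->//|/xmin/ltnW //].
have last_n : (last x l < n)%N.
  have : last x l \in map val s by rewrite sE mem_last.
  by case/mapP => j _ ->; exact: ltn_ord.
set G := \prod_(d <- gaps x l) _; move: (last x l) x_last last_n => y xy yn.
clearbody G; clear - n3 xy yn G corner_two_p.
have [yE|yN1] := eqVneq y (n - 1)%N.
  have -> : (x + n - y).-1 = x by lia.
  have -> : (y < n - 2)%N = false by lia.
  have -> : (y < n - 1)%N = false by lia.
  rewrite !andbF.
  case: (ltngtP x 1) => [|x1|->] /=.
  - by case: (x) => //= _; rewrite corner0 mulr1 !addr0.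
  - have -> : (x == 0)%N = false by lia.
    by rewrite corner_two_p // subn1 mulrC !(add0r, addr0).
  by rewrite corner1 mulr0 !addr0.
case: (posnP x) => [->|x0] /=.
  rewrite !addr0 add0r.
  have [y2|y2] := ltnP y (n - 2).
    rewrite corner_two_p; last by lia.
    by congr (_ * two_p _ _); lia.
  have -> : (0 + n - y).-1 = 1%N by lia.
  by rewrite corner1 mulr0.
have -> : (y < n - 1)%N by lia.
rewrite andbF !add0r.
rewrite corner_two_p; last by lia.
rewrite [RHS]mulrC.
by congr (two_p _ _ * _); lia.
Qed.

End TSums.

(** * Sequences of length n - 1 and n *)

Section ExtremeSizes.

Variables n m : nat.

Local Notation D := (coarse_mx 0 m%:Z).

Let sumn_gaps x l : path ltn x l -> (sumn (gaps x l) + x)%N = last x l.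
Proof.
by elim: l x => //= y l IH x /andP[xy /IH <-]; rewrite addnAC subnK 1?ltnW // addnC.
Qed.

Let size_le_sumn (g : seq nat) : all (ltn 0) g -> (size g <= sumn g)%N.
Proof. by elim: g => //= x g IH /andP[x0 /IH]; lia. Qed.

Let sumn_all1 g : all (ltn 0) g -> sumn g = size g -> all (pred1 1) g.
Proof.
elim: g => //= x g IH /andP[x0 g0] sg; have := size_le_sumn g0 => szg.
by rewrite IH //; lia.
Qed.

Let sumn_has2 g : all (ltn 0) g -> sumn g = (size g).+1 -> 2 \in g.
Proof.
elim: g => //= x g IH /andP[x0 g0] sg; have := size_le_sumn g0 => szg.
rewrite inE; case: (ltngtP x 2) => [x1|x2|_] //; last by lia.
by rewrite IH ?orbT //; lia.
Qed.

(** With the closing gap appended, the gaps go once round the cycle, hence their sum n. *)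
Let cyclic_gaps k (s : k.+1.-tuple 'I_n) : sorted ltn (map val s) ->
  exists g, [/\ size g = k.+1, all (ltn 0) g, sumn g = n &
    cyclic_weight D n (map val s) = \prod_(d <- g) corner D d.-1].
Proof.
case sE: (map val s) (size_map val s) => [|x l] /=; rewrite size_tuple // => -[szl] xl.
have last_n : (last x l < n)%N.
  have : last x l \in map val s by rewrite sE mem_last.
  by case/mapP => j _ ->; exact: ltn_ord.
exists (rcons (gaps x l) (x + n - last x l)%N); split.
- by rewrite size_rcons size_pairmap szl.
- rewrite all_rcons; apply/andP; split; first by rewrite /= subn_gt0 ltn_addl.
  exact: gaps_gt0.
- have := sumn_gaps xl; rewrite -cats1 sumn_cat /= => sg.
  by move: (sumn _) (last _ _) last_n sg => u v; clear; lia.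
by rewrite -cats1 big_cat big_seq1.
Qed.

(** Among n - 1 positive gaps of sum n one equals 2, and its factor is 0. *)
Lemma weight_pred : (1 < n)%N -> forall s : (n - 1).-tuple 'I_n,
  sorted ltn (map val s) -> cyclic_weight D n (map val s) = 0.
Proof.
case: n cyclic_gaps => [|[|k]] // cg _; rewrite subn1 /= => s /cg [g [sz g0 sg ->]].
have g2 : 2 \in g by apply: sumn_has2; rewrite ?sg ?sz.
by rewrite (big_rem _ g2) /= corner1 mul0r.
Qed.

(** All n gaps are 1, and there is a single increasing sequence of length n. *)
Lemma sum_weight_full : (0 < n)%N ->
  \sum_(s : n.-tuple 'I_n | sorted ltn (map val s)) cyclic_weight D n (map val s) = 1.
Proof.
case: n cyclic_gaps => [|k] // cg _.
transitivity (\sum_(s : k.+1.-tuple 'I_k.+1 | sorted ltn (map val s)) (1 : int)).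
  apply: eq_bigr => s /cg [g [sz g0 sg ->]].
  have /allP g1 : all (pred1 1) g by apply: sumn_all1; rewrite ?sg ?sz.
  by apply: big1_seq => d /andP[_ /g1 /eqP ->]; rewrite corner0.
by rewrite sumr_const -[X in _ *+ X]cardsE card_ltn_sorted_tuples binn.
Qed.

End ExtremeSizes.

Theorem proposition6 (n m : nat) (hn : (4 <= n)%N) (hm : (3 <= m)%N)
    (a b : 'I_m) (hab : a != b) :
  (hom_count (cycle_graph n) (quasi_complete a b))%:Z =
    (m%:Z - 1) * ((m%:Z - 1) ^+ (n - 1) + (-1) ^+ n)
      - \sum_(1 <= k < n.+1) t_term n m k.
Proof.
have n0 : (0 < n)%N by lia.
pose T k : int := \sum_(s : k.-tuple 'I_n | sorted ltn (map val s))
  cyclic_weight (coarse_mx 0 m%:Z) n (map val s).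
have sumT : \sum_(1 <= k < n.+1) T k =
    (m%:Z - 1) ^+ n + (-1) ^+ n - \tr (coarse_mx 0 m%:Z ^+ n).
  rewrite -coarse_mx1_trace.
  have -> : coarse_mx 1 m%:Z = delta_mx 0 0 + coarse_mx 0 m%:Z.
    apply/matrixP => i j; rewrite !mxE.
    by case: (i == 0); case: (j == 0); rewrite /= ?add0r ?addr0.
  rewrite trace_corner_expansion.
  rewrite (sum_sorted_tuples (fun s => cyclic_weight _ n (map val s))).
  (* The term k = 0 is the empty set of positions, which yields the trace of D^n. *)
  rewrite [in RHS]big_nat_recl //.
  rewrite (big_tuple0 (fun s => sorted ltn (map val s))
    (fun s => cyclic_weight _ n (map val s))) /= addrC addKr.
  by rewrite big_add1.
have sumt : \sum_(1 <= k < n.+1) t_term n m k =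
    \sum_(1 <= k < n.+1) T k + (-1) ^+ n.
  rewrite !(big_nat_recr n) //= -addrA; congr (_ + _).
    apply: eq_big_nat => k /andP[k0 kn].
    rewrite /t_term ltn_eqF //; case: eqP => [->|_].
      by rewrite /T big1 // => s; apply: weight_pred; lia.
    by case: k k0 {kn} => // k _; rewrite t_sums_sorted.
  (* At k = n the prescribed value, 2 or 0, is 1 + (-1)^n, whereas the weights sum to 1. *)
  rewrite /t_term eqxx /T sum_weight_full // -signr_odd.
  by case: (odd n); rewrite ?expr1 ?subrr.
have -> : (hom_count (cycle_graph n) (quasi_complete a b))%:Z =
    \tr (coarse_mx 0 m%:Z ^+ n) + (m%:Z - 3) * (-1) ^+ n.
  rewrite hom_cycle_trace; last by lia.
  by have := quasi_complete_trace hab n.-1; rewrite prednK.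
(* The coefficient m - 1 of (-1)^n is m - 3 from the trace for K_m^1, 1 from the trace of (D + E)^n
   and 1 from the term k = n. *)
rewrite sumt sumT; case: n n0 {hn T sumT sumt} => // k _.
rewrite subn1 /= [(m%:Z - 1) ^+ k.+1]exprS; ring.
Qed.
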